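(* There exists $\delta>0$ such that every triangle-free graph $G$ on $n$ vertices which can be $\delta$-approximated by the Petersen graph contains a set of $\lfloor n/2\rfloor$ vertices spanning at most $n^2/50$ edges.
   Context: With $V(P)=\{1,\dots,10\}$ for the Petersen graph $P$, a graph $G$ of order $n$ can be $\delta$-approximated by $P$ if there is a partition $V(G)=V_1\cup\dots\cup V_{10}$ with $||V_i|-n/10|\le\delta n$ for all $i$ and $|E(G)\triangle E(H_{\mathcal V})|\le\delta n^2$, where $H_{\mathcal V}$ is the graph on $V(G)$ with each $V_i$ independent, $V_i,V_j$ completely joined if $ij\in E(P)$ and with no edges between them otherwise. *)

(* Defs.v *)
From mathcomp Require Import all_boot all_order all_algebra.
From mathcomp Require Import reals.

Set Implicit Arguments.
Unset Strict Implicit.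
Unset Printing Implicit Defensive.

Import Order.TTheory GRing.Theory Num.Theory.

Definition simple_graph (T : finType) (e : rel T) : Prop :=
  symmetric e /\ irreflexive e.

(* An edge is the unordered pair [set x; y], so each edge is counted once. *)
Definition edges (T : finType) (e : rel T) : {set {set T}} :=
  [set [set xy.1; xy.2] | xy : T * T & e xy.1 xy.2].

Definition spanned_edges (T : finType) (e : rel T) (S : {set T}) :
    {set {set T}} :=
  [set a in edges e | a \subset S].

Definition triangle_free (T : finType) (e : rel T) : Prop :=
  forall x y z : T, ~~ [&& e x y, e y z & e x z].

Definition symdiff (U : finType) (A B : {set U}) : {set U} :=
  (A :\: B) :|: (B :\: A).

(* The standard drawing: outer cycle 0 1 2 3 4, spokes joining i to i + 5,
   and inner pentagram 5 7 9 6 8, each edge listed in one direction. *)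
Definition petersen_arc (i j : nat) : bool :=
  [|| (i < 5) && (j == i.+1 %% 5),
      (i < 5) && (j == i + 5)
    | (5 <= i) && (j == 5 + (i - 5 + 2) %% 5)].

Definition petersen : rel 'I_10 :=
  fun i j => petersen_arc i j || petersen_arc j i.

Lemma petersen_simple_graph : simple_graph petersen.
Proof.
split; first by move=> i j; rewrite /petersen orbC.
by case; do 10?[case=> //].
Qed.

(* Indexed partition; parts are allowed to be empty. *)
Definition partition_family (T I : finType) (V : I -> {set T}) : Prop :=
  \bigcup_i V i = [set: T] /\ (forall i j, i != j -> [disjoint V i & V j]).

Definition blowup (T I : finType) (P : rel I) (V : I -> {set T}) : rel T :=
  fun x y => [exists i, exists j, [&& P i j, x \in V i & y \in V j]].

Lemma blowup_simple_graph (T I : finType) (P : rel I) (V : I -> {set T}) :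
  simple_graph P -> partition_family V -> simple_graph (blowup P V).
Proof.
move=> [Psym Pirr] [_ Vdisj]; split=> [x y | x].
  by apply/idP/idP=> /existsP[i /existsP[j /and3P[Pij xi yj]]];
    apply/existsP; exists j; apply/existsP; exists i; rewrite Psym Pij xi yj.
apply/negbTE/negP=> /existsP[i /existsP[j /and3P[Pij xi xj]]].
have [eq_ij | /Vdisj/disjointFr/(_ xi)] := eqVneq i j; last by rewrite xj.
by rewrite eq_ij Pirr in Pij.
Qed.

Local Open Scope ring_scope.

Definition petersen_approximable (R : realType) (delta : R)
    (T : finType) (e : rel T) : Prop :=
  exists V : 'I_10 -> {set T},
    [/\ partition_family V,
        forall i, `|#|V i|%:R - #|T|%:R / 10| <= delta * #|T|%:R
      & #|symdiff (edges e) (edges (blowup petersen V))|%:R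
          <= delta * #|T|%:R ^+ 2].

(* Main.v *)
Require Import Defs.
From mathcomp Require Import all_boot all_order all_algebra.
From mathcomp Require Import reals.
From mathcomp Require Import ring lra zify.

Set Implicit Arguments.
Unset Strict Implicit.
Unset Printing Implicit Defensive.

Import Order.TTheory GRing.Theory Num.Theory.
Local Open Scope ring_scope.

(* It is enough to find fractional weights w : V -> [0, 1] of total n/2 with
   sum_(uv in E) w_u w_v <= n^2/50: moving mass between two vertices is a
   concave move, so the weights can be rounded.

   In a triangle-free graph close to the blow-up, the parts in which a vertex v
   has a linear number of neighbours form an independent set of the Petersen
   graph. Such a set lies in the neighbourhood of some i, and then v is put in
   class i, or in one of the five independent 4-sets I_x, and then v is put in an
   exceptional class B_x. Edges between non-adjacent ordinary classes need an end
   that misses a linear number of the expected edges, so they are paid for by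
   those missing edges.

   Take x with |B_x| maximal. The complement of I_x is a perfect matching, with
   transversals J and J'. With a(.) denoting sizes, use four weightings: I_x full
   and mass (n/2 - a(I_x))/3 on each class of J, or of J' (probability 1/20
   each); J and B_x full and mass (n/2 - a(J) - a(B_x))/3 on each class of J', or
   the same with J and J' exchanged (probability 9/20 each). The probabilities
   make the first-order terms in the class sizes cancel up to the sizes of the
   B_y, the second-order terms are nonpositive, and every edge of the Petersen
   graph is seen by one of the weightings, so missing edges help. Hence the
   average cost is at most n^2/50. *)

(** * Counting edges and rounding weights *)

(** Each edge is the image of exactly two ordered pairs, distinct because there are no loops. *)
Lemma card_edges (T : finType) (r : rel T) : simple_graph r ->
  (#|edges r| * 2)%N = #|[set p : T * T | r p.1 p.2]|.
Proof.
move=> [rsym rirr]; pose f (p : T * T) := [set p.1; p.2].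
rewrite -[RHS]sum1_card (partition_big_imset f) /= -sum_nat_const.
have -> : f @: [set p : T * T | r p.1 p.2] = edges r.
  by apply: eq_imset => // p; rewrite inE.
apply: eq_bigr => A /imsetP[[x y] /= rxy ->].
have rxy' : r x y by move: rxy; rewrite inE.
have xNy : x != y by apply: contraTneq rxy' => ->; rewrite rirr.
rewrite sum1_card -[LHS](_ : #|[set (x, y); (y, x)]| = 2).
  apply: eq_card => -[u v]; rewrite [in RHS]unfold_in /= !inE !xpair_eqE /=.
  apply/idP/idP.
    case/orP=> /andP[/eqP-> /eqP->]; first by rewrite rxy' eqxx.
    by rewrite rsym rxy' setUC eqxx.
  case/andP=> ruv /eqP E.
  have uNv : u != v by apply: contraTneq ruv => ->; rewrite rirr.
  have : u \in [set x; y] by rewrite -E !inE eqxx.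
  have : v \in [set x; y] by rewrite -E !inE eqxx orbT.
  move: uNv; rewrite !inE => uNv.
  case/orP=> /eqP Ev; case/orP=> /eqP Eu; move: uNv; subst u v; rewrite ?eqxx //= ?orbT //.
by rewrite cards2 xpair_eqE (negPf xNy).
Qed.

Lemma spanned_edgesE (T : finType) (e : rel T) (S : {set T}) :
  spanned_edges e S = edges [rel x y | [&& e x y, x \in S & y \in S]].
Proof.
apply/setP=> A; rewrite inE; apply/andP/imsetP.
  case=> /imsetP[[x y] /= exy ->] /subsetP sub.
  exists (x, y) => //=; rewrite inE /=.
  by move: exy; rewrite inE /= => ->; rewrite !sub // !inE eqxx ?orbT.
case=> -[x y] /=; rewrite inE /= => /and3P[exy xS yS] ->; split.
  by apply/imsetP; exists (x, y); rewrite ?inE.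
by apply/subsetP=> z; rewrite !inE => /orP[]/eqP->.
Qed.

Lemma mem_edges (T : finType) (r : rel T) (x y : T) : symmetric r ->
  ([set x; y] \in edges r) = r x y.
Proof.
move=> rsym; apply/imsetP/idP => [[[u v] /= ruv E]|rxy]; last by exists (x, y); rewrite ?inE.
have ruv' : r u v by move: ruv; rewrite inE.
have : x \in [set u; v] by rewrite -E !inE eqxx.
have : y \in [set u; v] by rewrite -E !inE eqxx orbT.
have : u \in [set x; y] by rewrite E !inE eqxx.
have : v \in [set x; y] by rewrite E !inE eqxx orbT.
rewrite !inE.
by do 4![case/orP=> /eqP ?]; subst; rewrite // rsym.
Qed.

(** With [card_edges], this turns the approximation hypothesis into a count of ordered pairs on
    which two relations differ. *)
Lemma symdiff_edges (T : finType) (r s : rel T) :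
  symmetric r -> symmetric s ->
  symdiff (edges r) (edges s) = edges [rel x y | r x y != s x y].
Proof.
move=> rsym ssym.
have tsym : symmetric [rel x y | r x y != s x y].
  by move=> x y /=; rewrite rsym ssym.
apply/setP=> A; rewrite !inE.
case E : (A \in edges [rel x y | r x y != s x y]).
  case/imsetP: E => -[x y] /= rs ->; rewrite !mem_edges //.
  by move: rs; rewrite inE /=; case: (r x y); case: (s x y).
apply/negP => /orP[] /andP[nA]; move: E nA => /negbT;
  move=> E nA /imsetP[[x y] /= rxy AE]; move: E nA; rewrite AE !mem_edges //=;
  move: rxy; rewrite inE /= => ->; by case: (_ x y).
Qed.

Lemma sumr_bool (R : pzSemiRingType) (T : finType) (P : pred T) :
  \sum_u (P u)%:R = #|[set u | P u]|%:R :> R.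
Proof.
rewrite -sum1_card natr_sum [RHS]big_mkcond; apply: eq_bigr => u _.
by rewrite inE; case: (P u).
Qed.

Section Rounding.
Variables (R : realFieldType) (T : finType) (e : rel T).
Hypothesis esimple : simple_graph e.
Implicit Type w : T -> R.

(** The sum is over ordered pairs, so a 0/1 weighting gets twice the number of edges it spans; the
    target is therefore n^2/25. *)
Definition edge_form w : R := \sum_u \sum_v w u * w v * (e u v)%:R.

(** Symmetry merges the two cross terms; without loops the pair [u], [v] alone contributes to second
    order, with a negative sign. *)
Lemma edge_form_shift w u v t : u != v ->
  edge_form (fun z => w z + t * ((z == u)%:R - (z == v)%:R)) =
  edge_form w
  + 2 * t * (\sum_z w z * (e u z)%:R - \sum_z w z * (e v z)%:R)
  - 2 * t ^+ 2 * (e u v)%:R.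
Proof.
move=> uNv; have [esym eirr] := esimple.
pose d z : R := (z == u)%:R - (z == v)%:R.
have sumd (f : T -> R) : \sum_z d z * f z = f u - f v.
  under eq_bigr do rewrite /d mulrBl.
  rewrite big_split /= sumrN; congr (_ - _).
    rewrite (bigD1 u) //= eqxx mul1r big1 ?addr0 // => z /negPf->.
    by rewrite mul0r.
  rewrite (bigD1 v) //= eqxx mul1r big1 ?addr0 // => z /negPf->.
  by rewrite mul0r.
pose g x := \sum_y w y * (e x y)%:R.
rewrite -[X in _ + _ * X - _]/(g u - g v).
transitivity (\sum_x (w x * g x + t * (d x * g x)
     + t * (w x * ((e x u)%:R - (e x v)%:R))
     + t ^+ 2 * (d x * ((e x u)%:R - (e x v)%:R)))).
  apply: eq_bigr => x _.
  transitivity (\sum_y (w x * (w y * (e x y)%:R) + t * d x * (w y * (e x y)%:R)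
     + t * w x * (d y * (e x y)%:R) + t ^+ 2 * d x * (d y * (e x y)%:R))).
    by apply: eq_bigr => y _; rewrite -/(d x) -/(d y); ring.
  by rewrite !big_split /= -!mulr_sumr sumd -/(g x); ring.
rewrite !big_split /= -!mulr_sumr !sumd.
have -> : \sum_x w x * g x = edge_form w.
  by apply: eq_bigr => x _; rewrite mulr_sumr; apply: eq_bigr => y _; ring.
have -> : \sum_x w x * ((e x u)%:R - (e x v)%:R) = g u - g v.
  rewrite /g -sumrB; apply: eq_bigr => y _.
  by rewrite (esym y u) (esym y v); ring.
by rewrite !eirr (esym v u) /= !mulr0n; ring.
Qed.

(* Moving mass from [v] to [u] is a concave move, so it can be continued until
   one of the two weights becomes integral. *)
Lemma round_weights (w : T -> R) (m : nat) :
  (forall u, 0 <= w u <= 1) -> \sum_u w u = m%:R ->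
  exists S : {set T}, #|S| = m /\
    \sum_(u in S) \sum_(v in S) (e u v)%:R <= edge_form w.
Proof.
have [k] := ubnP #|[set u | 0 < w u < 1]|.
elim: k w => // k IH w le_k w01 sumw.
pose S := [set u | w u == 1].
have [fr0|[u ufr]] := set_0Vmem [set u | 0 < w u < 1].
  have wE u : w u = (u \in S)%:R.
    have /andP[w0 w1] := w01 u.
    have : u \notin [set u | 0 < w u < 1] by rewrite fr0 inE.
    rewrite !inE !lt_neqAle w0 w1 !andbT negb_and !negbK eq_sym.
    by case/orP=> /eqP->; rewrite ?eqxx // eq_sym oner_eq0.
  exists S; split.
    apply/eqP; rewrite -(eqr_nat R) -sumw.
    by rewrite (eq_bigr _ (fun u _ => wE u)) sumr_bool cardsE.
  rewrite /edge_form big_mkcond; apply: ler_sum => u _.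
  rewrite wE; case: (u \in S); last first.
    by rewrite big1 // => v _; rewrite !mul0r.
  rewrite big_mkcond; apply: ler_sum => v _.
  by rewrite wE; case: (v \in S); rewrite ?mulr1 ?mul1r ?mulr0 ?mul0r.
(* With a single fractional weight, the integer [m] would lie strictly between [#|S|] and
   [#|S| + 1]. *)
have [v vfr uNv] : exists2 v, v \in [set u | 0 < w u < 1] & u != v.
  have [/existsP[v /andP[vfr uNv]]|/existsPn nov] :=
    boolP [exists v, (v \in [set u | 0 < w u < 1]) && (u != v)].
    by exists v.
  move: ufr; rewrite inE => /andP[u0 u1].
  have wE z : z != u -> w z = (z \in S)%:R.
    move=> zu; have /andP[w0 w1] := w01 z.
    have := nov z; rewrite eq_sym zu andbT.
    rewrite !inE !lt_neqAle w0 w1 !andbT negb_and !negbK eq_sym.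
    by case/orP=> /eqP->; rewrite ?eqxx // eq_sym oner_eq0.
  have uS : u \notin S by rewrite inE lt_eqF.
  have E : w u + #|S|%:R = m%:R.
    rewrite -sumw (bigD1 u) //=; congr (_ + _).
    rewrite (eq_bigr _ wE) -(cardsE (mem S)) -sumr_bool (bigD1 u) //=.
    by rewrite (negPf uS) add0r.
  have : (#|S| < m)%N by rewrite -(ltr_nat R) -E; lra.
  have : (m < #|S|.+1)%N by rewrite -(ltr_nat R) -E -natr1; lra.
  lia.
(* The vertex whose neighbourhood weighs less receives the mass, so the linear term does not
   increase. *)
wlog le_uv : u v ufr vfr uNv / \sum_z w z * (e u z)%:R <= \sum_z w z * (e v z)%:R.
  move=> W; case/orP: (le_total (\sum_z w z * (e u z)%:R) (\sum_z w z * (e v z)%:R)) => le.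
    exact: (W u v).
  by apply: (W v u) => //; rewrite eq_sym.
move: (ufr) (vfr); rewrite !inE => /andP[u0 u1] /andP[v0 v1].
(* The largest shift that keeps both weights in [0, 1]: it brings [u] to 1 or [v] to 0. *)
pose t := Num.min (1 - w u) (w v).
have t0 : 0 < t by rewrite lt_min; apply/andP; split; lra.
have tu : t <= 1 - w u by rewrite ge_min lexx.
have tv : t <= w v by rewrite ge_min lexx orbT.
pose w' z := w z + t * ((z == u)%:R - (z == v)%:R).
have w'u : w' u = w u + t by rewrite /w' eqxx (negPf uNv) subr0 mulr1.
have w'v : w' v = w v - t by rewrite /w' eqxx eq_sym (negPf uNv) sub0r mulrN1.
have w'z z : z != u -> z != v -> w' z = w z.
  by rewrite /w' => /negPf-> /negPf->; rewrite subr0 mulr0 addr0.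
have le_w' : edge_form w' <= edge_form w.
  rewrite edge_form_shift //.
  have : 0 <= t ^+ 2 * (e u v)%:R by rewrite mulr_ge0 ?ler0n // sqr_ge0.
  set q := t ^+ 2 * _; rewrite -[2 * t ^+ 2 * _]mulrA -/q.
  move: le_uv; set A := \sum_z _; set B := \sum_z _ => AB.
  have : t * (A - B) <= 0 by nra.
  rewrite -[2 * t * _]mulrA; lra.
have sum_w' : \sum_z w' z = m%:R.
  rewrite /w' big_split /= sumw -mulr_sumr sumrB !sumr_bool.
  have card_eq x : #|[set z : T | z == x]| = 1%N.
    by rewrite -(cards1 x); apply: eq_card => z; rewrite !inE.
  by rewrite !card_eq subrr mulr0 addr0.
have w'01 z : 0 <= w' z <= 1.
  have [->|zu] := eqVneq z u; first by rewrite w'u; apply/andP; split; lra.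
  have [->|zv] := eqVneq z v; first by rewrite w'v; apply/andP; split; lra.
  by rewrite w'z.
suff lt_k : (#|[set z | (0 < w' z < 1)%R]| < k)%N.
  have [S' [cS' leS']] := IH w' lt_k w'01 sum_w'.
  by exists S'; split=> //; apply: le_trans leS' le_w'.
rewrite -ltnS; apply: leq_trans le_k; rewrite ltnS; apply: proper_card; apply/properP; split.
  apply/subsetP=> z; rewrite !inE.
  have [->|zu] := eqVneq z u; first by rewrite u0 u1.
  have [->|zv] := eqVneq z v; first by rewrite v0 v1.
  by rewrite w'z.
have [ltt|let_] := ltP (1 - w u) (w v).
  by exists u => //; rewrite inE w'u /t min_l ?ltW //; apply/negP=> /andP[_]; lra.
exists v => //; rewrite inE w'v /t min_r //.
by apply/negP=> /andP[]; lra.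
Qed.

Lemma sparse_half_of_weights (w : T -> R) :
  (forall u, 0 <= w u <= 1) -> \sum_u w u = #|T|%:R / 2 ->
  exists S : {set T}, #|S| = #|T|./2 /\
    2 * #|spanned_edges e S|%:R <= edge_form w.
Proof.
move=> w01 sumw; have [esym eirr] := esimple.
(* Rescales the total from n/2 to its floor, which matters for odd n; the form is multiplied by
   [c ^+ 2 <= 1]. For empty [T] division by zero gives [c = 0]. *)
pose c : R := (#|T|./2)%:R / (#|T|%:R / 2).
have half_le : (#|T|./2)%:R <= #|T|%:R / 2 :> R.
  have := leq_addl (odd #|T|) #|T|./2.*2; rewrite odd_double_half -muln2.
  rewrite -(ler_nat R) natrM; lra.
have c0 : 0 <= c by rewrite divr_ge0 // ?divr_ge0 ?ler0n.
have c1 : c <= 1.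
  have [T0|T0] := eqVneq #|T| 0%N; first by rewrite /c T0 /= mul0r.
  rewrite ler_pdivrMr ?mul1r // divr_gt0 // ltr0n lt0n //.
have cw01 u : 0 <= c * w u <= 1.
  by have /andP[? ?] := w01 u; rewrite mulr_ge0 //= mulr_ile1.
have sumcw : \sum_u c * w u = (#|T|./2)%:R.
  rewrite -mulr_sumr sumw /c.
  have [T0|T0] := eqVneq #|T| 0%N; first by rewrite T0 /= !mul0r.
  by rewrite divfK // mulf_neq0 ?pnatr_eq0 // invr_eq0 pnatr_eq0.
have [S [cS leS]] := round_weights cw01 sumcw.
exists S; split=> //.
have -> : 2 * #|spanned_edges e S|%:R = \sum_(u in S) \sum_(v in S) (e u v)%:R :> R.
  rewrite -natrM mulnC spanned_edgesE card_edges; last first.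
    by split=> [x y|x] /=; rewrite ?eirr // esym [X in _ && X]andbC.
  rewrite -sumr_bool pair_big [RHS]big_mkcond /=; apply: eq_bigr => -[x y] _ /=.
  by case: (x \in S); case: (y \in S); rewrite ?andbT ?andbF.
apply: le_trans leS _.
have -> : edge_form (fun u => c * w u) = c ^+ 2 * edge_form w.
  rewrite /edge_form mulr_sumr; apply: eq_bigr => u _.
  by rewrite mulr_sumr; apply: eq_bigr => v _; ring.
apply: ler_piMl; last by rewrite exprn_ile1.
apply: sumr_ge0 => u _; apply: sumr_ge0 => v _.
have /andP[? _] := w01 u; have /andP[? _] := w01 v.
by rewrite !mulr_ge0 // ler0n.
Qed.
End Rounding.

(** * Combinatorics of the Petersen graph *)

(* The Petersen graph on the labels 0..9; the labels 10..14 are isolated. *)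
Definition adj (i j : nat) : bool :=
  [&& i < 10, j < 10 & petersen_arc i j || petersen_arc j i]%N.

(* The independent set I_x of size 4; the rotation [rot_class x] sends it to I_0. *)
Definition star (x : nat) : seq nat :=
  [:: x; (x + 2) %% 5; 5 + (x + 3) %% 5; 5 + (x + 4) %% 5]%N.

Lemma forall_ord_iota (n : nat) (P : nat -> bool) :
  all P (iota 0 n) -> forall i : 'I_n, P i.
Proof. by move=> /allP allP i; apply: allP; rewrite mem_iota /= ltn_ord. Qed.

Lemma forall_ord_iota2 (m n : nat) (P : nat -> nat -> bool) :
  all (fun i => all (P i) (iota 0 n)) (iota 0 m) ->
  forall (i : 'I_m) (j : 'I_n), P i j.
Proof. by move=> /forall_ord_iota allP i; apply: forall_ord_iota (allP i). Qed.

Lemma adj_sym : symmetric adj.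
Proof. by move=> i j; rewrite /adj orbC andbCA. Qed.

Lemma petersenE (i j : 'I_10) : petersen i j = adj i j.
Proof. by rewrite /adj !ltn_ord. Qed.

(** The Petersen graph has diameter 2; for [i = j] any neighbour serves. *)
Lemma common_neighbour (i j : 'I_10) : ~~ adj i j ->
  exists2 k : 'I_10, adj i k & adj j k.
Proof.
move=> Nij.
pose P (c d : nat) := ~~ adj c d ==> has (fun k => adj c k && adj d k) (iota 0 10).
have /implyP/(_ Nij)/hasP[k] := @forall_ord_iota2 10 10 P isT i j.
by rewrite mem_iota /= add0n => k10 /andP[ik jk]; exists (Ordinal k10).
Qed.

Fixpoint bitseqs (n : nat) : seq bitseq :=
  if n is m.+1 then map (cons true) (bitseqs m) ++ map (cons false) (bitseqs m)
  else [:: [::]].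

Lemma mem_bitseqs (s : bitseq) : s \in bitseqs (size s).
Proof.
elim: s => //= b s IH; rewrite mem_cat; apply/orP.
by case: b; [left|right]; apply: map_f.
Qed.

(** Checked on all 1024 subsets of the ten vertices, encoded as bit sequences. *)
Lemma independent_cases (D : nat -> bool) :
  (forall i j, (i < 10)%N -> (j < 10)%N -> D i -> D j -> ~~ adj i j) ->
  (exists2 i, (i < 10)%N & forall k, (k < 10)%N -> D k -> adj i k) \/
  (exists2 x, (x < 5)%N & forall k, (k < 10)%N -> D k -> k \in star x).
Proof.
move=> Dind.
pose indep (s : bitseq) := all (fun i => all (fun j =>
   nth false s i && nth false s j ==> ~~ adj i j) (iota 0 10)) (iota 0 10).
pose within (s : bitseq) (P : pred nat) :=
  all (fun k => nth false s k ==> P k) (iota 0 10).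
pose covered (s : bitseq) := has (fun i => within s (adj i)) (iota 0 10)
   || has (fun x => within s (mem (star x))) (iota 0 5).
have allb : all (fun s => indep s ==> covered s) (bitseqs 10).
  by vm_compute.
pose s := mkseq D 10.
have sE k : (k < 10)%N -> nth false s k = D k by move=> k10; rewrite nth_mkseq.
have withinP (P : pred nat) : within s P -> forall k, (k < 10)%N -> D k -> P k.
  move=> /allP h k k10 Dk; have := h k; rewrite mem_iota /= add0n k10 sE // Dk.
  by move=> /(_ isT).
have s10 : s \in bitseqs 10 by have := mem_bitseqs s; rewrite size_mkseq.
have /allP/(_ s s10)/implyP h := allb.
have /h : indep s.
  apply/allP=> i i_iota; apply/allP=> j j_iota.
  have i10 : (i < 10)%N by move: i_iota; rewrite mem_iota.
  have j10 : (j < 10)%N by move: j_iota; rewrite mem_iota.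
  by rewrite !sE //; apply/implyP=> /andP[Di Dj]; apply: Dind.
case/orP=> /hasP[i]; rewrite mem_iota /= add0n => i10 /withinP w.
  by left; exists i.
by right; exists i.
Qed.

(** The five-fold symmetry of the drawing, turned back by [x]. It acts separately on the outer
    cycle, the inner vertices and the labels of the exceptional classes, so that [10 + x] goes to
    10. *)
Definition rot_class (x c : nat) : nat :=
  (if c < 5 then (c + 5 - x) %% 5
   else if c < 10 then 5 + (c - x) %% 5
   else 10 + (c - 5 - x) %% 5)%N.

Definition unrot_class (x : nat) : nat -> nat := rot_class ((5 - x) %% 5).

Lemma rot_class_facts (x c d : nat) : (x < 5 -> c < 15 -> d < 15 ->
  [/\ rot_class x c < 15,
      adj (rot_class x c) (rot_class x d) = adj c d,
      (rot_class x c == d) = (c == unrot_class x d),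
      (c < 10) = (rot_class x c < 10) & (unrot_class x d < 15) /\
      ((d < 10) = (unrot_class x d < 10))])%N.
Proof.
move=> x5 c15 d15.
pose P x c d := [&& rot_class x c < 15,
      adj (rot_class x c) (rot_class x d) == adj c d,
      (rot_class x c == d) == (c == unrot_class x d),
      (c < 10) == (rot_class x c < 10), unrot_class x d < 15 &
      (d < 10) == (unrot_class x d < 10)]%N.
pose Q x c := all (P x c) (iota 0 15).
have allQ : all (fun x => all (Q x) (iota 0 15)) (iota 0 5) by vm_compute.
have hQ := @forall_ord_iota2 5 15 Q allQ (Ordinal x5) (Ordinal c15).
have := @forall_ord_iota 15 (P x c) hQ (Ordinal d15).
by case/and5P=> ? /eqP? /eqP? /eqP? /andP[? /eqP?].
Qed.

Lemma rot_class_star (x c : nat) : (x < 5)%N -> (c < 10)%N ->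
  (rot_class x c \in star 0) = (c \in star x).
Proof.
move=> x5 c10.
pose P x c := (rot_class x c \in star 0) == (c \in star x).
exact/eqP/(@forall_ord_iota2 5 10 P isT (Ordinal x5) (Ordinal c10)).
Qed.

Section Cards.
Variables (R : realFieldType) (T : finType).

Lemma card_set_ler (P Q : pred T) : (forall u, P u -> Q u) ->
  #|[set u | P u]|%:R <= #|[set u | Q u]|%:R :> R.
Proof.
by move=> PQ; rewrite ler_nat subset_leq_card //; apply/subsetP=> u; rewrite !inE; apply: PQ.
Qed.

Lemma card_set_ler2 (P Q1 Q2 : pred T) : (forall u, P u -> Q1 u || Q2 u) ->
  #|[set u | P u]|%:R <= #|[set u | Q1 u]|%:R + #|[set u | Q2 u]|%:R :> R.
Proof.
move=> PQ; rewrite -!sumr_bool -big_split /=; apply: ler_sum => u _.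
rewrite -natrD ler_nat; have := PQ u.
by case: (P u) => // /(_ isT); case: (Q1 u); case: (Q2 u).
Qed.

Lemma sum2_bool (P : rel T) :
  \sum_u \sum_v (P u v)%:R = #|[set q : T * T | P q.1 q.2]|%:R :> R.
Proof. by rewrite pair_big /= sumr_bool. Qed.
End Cards.

(** * The four weightings *)

(* Classes that one weighting can use together; 10 is the label of B_0. *)
Definition compatible (c d : nat) : bool :=
  ((c < 10) && (d < 10) ||
   [&& c <= 10, d <= 10, c \notin star 0 & d \notin star 0])%N.

Lemma sum_ord15 (R : pzRingType) (f : nat -> R) :
  \sum_(c < 15) f c = f 0%N + f 1%N + f 2%N + f 3%N + f 4%N + f 5%N + f 6%N
    + f 7%N + f 8%N + f 9%N + f 10%N + f 11%N + f 12%N + f 13%N + f 14%N.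
Proof. by rewrite -(big_mkord predT f) /index_iota /= !big_cons big_nil addr0 !addrA. Qed.

Lemma adj_form (R : realFieldType) (m : nat -> R) :
  \sum_(c < 15) \sum_(d < 15) m c * m d * (adj c d)%:R =
  2 * (m 0%N * m 1%N + m 1%N * m 2%N + m 2%N * m 3%N + m 3%N * m 4%N
       + m 0%N * m 4%N + m 0%N * m 5%N + m 1%N * m 6%N + m 2%N * m 7%N
       + m 3%N * m 8%N + m 4%N * m 9%N + m 5%N * m 7%N + m 7%N * m 9%N
       + m 6%N * m 9%N + m 6%N * m 8%N + m 5%N * m 8%N).
Proof.
pose nbr c := [seq d <- iota 0 15 | adj c d].
have rowE c : \sum_(d < 15) m c * m d * (adj c d)%:R = m c * \sum_(d <- nbr c) m d.
  rewrite /nbr big_filter mulr_sumr [RHS]big_mkcond.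
  rewrite -(big_mkord predT (fun d => m c * m d * (adj c d)%:R)).
  by apply: eq_bigr => d _; case: (adj c d); rewrite ?mulr1 ?mulr0.
rewrite (sum_ord15 (fun c => \sum_(d < 15) m c * m d * (adj c d)%:R)) !rowE.
have [n0 n1 n2 n3] : [/\ nbr 0 = [:: 1; 4; 5], nbr 1 = [:: 0; 2; 6],
  nbr 2 = [:: 1; 3; 7] & nbr 3 = [:: 2; 4; 8]]%N by [].
have [n4 n5 n6 n7] : [/\ nbr 4 = [:: 0; 3; 9], nbr 5 = [:: 0; 7; 8],
  nbr 6 = [:: 1; 8; 9] & nbr 7 = [:: 2; 5; 9]]%N by [].
have [n8 n9 n10] : [/\ nbr 8 = [:: 3; 5; 6], nbr 9 = [:: 4; 6; 7] & nbr 10 = [::]]%N.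
  by [].
have [n11 n12 n13 n14] : [/\ nbr 11 = [::], nbr 12 = [::], nbr 13 = [::] &
   nbr 14 = [::]]%N by [].
rewrite n0 n1 n2 n3 n4 n5 n6 n7 n8 n9 n10 n11 n12 n13 n14 !big_cons !big_nil.
ring.
Qed.

(** In the deviations from 2N/5, 3N/10 and 3N/10 every linear term has coefficient -3N/100, and the
    deviations sum to -(b + b'). This adds at most 15Nb/100, while filling B_0 saves about 18Nb/100.
    The quadratic terms in the deviations are negative squares. *)
Lemma average_bound (R : realFieldType) (N s p q b b' : R) :
  N = s + p + q + b + b' -> 0 <= N -> 0 <= b -> b' <= 4 * b ->
  297 / 1000 * N <= p -> 297 / 1000 * N <= q ->
  1 / 20 * (6 * ((N / 2 - s) / 3) * s)
  + 9 / 20 * (2 * ((N / 2 - p - b) / 3) * p + 2 * ((N / 2 - q - b) / 3) * q)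
  <= N ^+ 2 / 25 - N * b / 50.
Proof.
move=> NE N0 b0 le_b' ple qle.
pose al := s - 2 / 5 * N; pose dp := p - 3 / 10 * N; pose dq := q - 3 / 10 * N.
have -> : s = 2 / 5 * N + al by rewrite /al addrC subrK.
have pE : p = 3 / 10 * N + dp by rewrite /dp addrC subrK.
have qE : q = 3 / 10 * N + dq by rewrite /dq addrC subrK.
have dE : al + dp + dq = - (b + b') by rewrite /al /dp /dq NE; field.
have h1 : N * b' <= N * (4 * b) by exact: ler_wpM2l.
have h2 : b * (- (6 / 1000 * N)) <= b * (dp + dq).
  by apply: ler_wpM2l => //; rewrite /dp /dq; lra.
have h3 : 0 <= N * b by exact: mulr_ge0.
have := sqr_ge0 al; have := sqr_ge0 dp; have := sqr_ge0 dq.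
have : N * (al + dp + dq) = - (N * (b + b')) by rewrite dE mulrN.
rewrite pE qE; clear -h1 h2 h3; nra.
Qed.

Section ClassWeights.
Variables (R : realFieldType) (T : finType) (e : rel T) (phi : T -> 'I_15).
Hypothesis esimple : simple_graph e.

Definition class_size (c : nat) : R := #|[set u | phi u == c :> nat]|%:R.
Local Notation a := class_size.

Definition missing (u v : T) : bool := adj (phi u) (phi v) && ~~ e u v.
(** Unexpected edges between incompatible classes are left out: no weighting is positive on both
    ends. *)
Definition extra (u v : T) : bool :=
  [&& e u v, ~~ adj (phi u) (phi v) & compatible (phi u) (phi v)].

Lemma sum_class (F : nat -> R) :
  \sum_u F (phi u) = \sum_(c < 15) a c * F c.
Proof.
rewrite (partition_big phi predT) //=; apply: eq_bigr => c _.
rewrite (eq_bigr (fun=> F c)) => [|u /eqP->//].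
rewrite sumr_const -mulr_natl; congr (_%:R * _).
by apply: eq_card => u; rewrite [RHS]inE.
Qed.

Lemma sum_class_size : \sum_(c < 15) a c = #|T|%:R.
Proof.
have := sum_class (fun=> 1); rewrite sumr_const => ->.
by apply: eq_bigr => c _; rewrite mulr1.
Qed.

(** Weights on the support are at least 3/10, so a missing pair there saves at least 9/100; an extra
    edge costs at most 1. *)
Lemma edge_form_class (W : nat -> R) (s : seq nat) :
  (forall c, 0 <= W c <= 1) ->
  (forall c, c \notin s -> W c = 0) ->
  (forall c, c \in s -> 3 / 10 <= W c) ->
  {in s &, forall c d, compatible c d} ->
  edge_form e (fun u => W (phi u)) <=
    \sum_(c < 15) \sum_(d < 15) (a c * W c) * (a d * W d) * (adj c d)%:R
    - 9 / 100 *
      \sum_u \sum_v [&& (phi u : nat) \in s, (phi v : nat) \in s & missing u v]%:R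
    + \sum_u \sum_v (extra u v)%:R.
Proof.
move=> W01 W0 Ws sok.
have -> : \sum_(c < 15) \sum_(d < 15) (a c * W c) * (a d * W d) * (adj c d)%:R
   = \sum_u \sum_v W (phi u) * W (phi v) * (adj (phi u) (phi v))%:R.
  rewrite (sum_class (fun c => \sum_v W c * W (phi v) * (adj c (phi v))%:R)).
  apply: eq_bigr => c _.
  rewrite (sum_class (fun d => W c * W d * (adj c d)%:R)) mulr_sumr.
  by apply: eq_bigr => d _; ring.
rewrite mulr_sumr -sumrB -big_split /=; apply: ler_sum => u _.
rewrite mulr_sumr -sumrB -big_split /=; apply: ler_sum => v _.
rewrite /missing /extra.
have /andP[Wu0 Wu1] := W01 (phi u); have /andP[Wv0 Wv1] := W01 (phi v).
have WW0 : 0 <= W (phi u) * W (phi v) by rewrite mulr_ge0.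
have WW1 : W (phi u) * W (phi v) <= 1 by rewrite mulr_ile1.
have [us|us] := boolP ((phi u : nat) \in s); last first.
  by rewrite (W0 _ us) !mul0r /= mulr0n mulr0 subr0 add0r ler0n.
have [vs|vs] := boolP ((phi v : nat) \in s); last first.
  by rewrite (W0 _ vs) mulr0 !mul0r /= ?mulr0n ?mulr0 subr0 add0r ler0n.
rewrite (sok _ _ us vs) andbT /=.
have WW9 : 9 / 100 <= W (phi u) * W (phi v).
  have := Ws _ us; have := Ws _ vs; nra.
by case: (e u v); case: (adj _ _) => /=; lra.
Qed.

Hypothesis T0 : (0 < #|T|)%N.
Local Notation N := (#|T|%:R : R).
Hypothesis size_near : forall i, (i < 10)%N -> `|a i - N / 10| <= N / 1000.
Hypothesis size_exc : forall c, (10 <= c < 15)%N -> a c <= a 10%N.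

Definition class_weight (F P : seq nat) (y : R) (c : nat) : R :=
  if c \in F then 1 else if c \in P then y / a c else 0.

(** The masses in use are close to N/30 or N/15, which explains the range for [y]; classes of size
    near N/10 then get weights in [3/10, 1]. *)
Lemma class_weight_bounds (F P : seq nat) (y : R) :
  {in P, forall c, (c < 10)%N} -> 31 / 1000 * N <= y -> y <= 7 / 100 * N ->
  [/\ forall c, 0 <= class_weight F P y c <= 1,
      forall c, c \notin F ++ P -> class_weight F P y c = 0 &
      forall c, c \in F ++ P -> 3 / 10 <= class_weight F P y c].
Proof.
move=> P10 ly uy; have N0 : 0 < N by rewrite ltr0n.
have ac c : c \in P -> 99 / 1000 * N <= a c <= 101 / 1000 * N.
  move=> /P10/size_near; rewrite ler_norml => /andP[? ?]; apply/andP; split; lra.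
have yc c : c \in P -> 3 / 10 <= y / a c <= 1.
  move=> /ac /andP[? ?]; have a0 : 0 < a c by lra.
  by rewrite ler_pdivlMr // ler_pdivrMr //; apply/andP; split; lra.
split=> c; rewrite /class_weight.
- case: ifP => _; first by rewrite ler01 lexx.
  case: ifP => [/yc/andP[? ?]|_]; last by rewrite lexx ler01.
  by apply/andP; split; lra.
- by rewrite mem_cat negb_or => /andP[/negPf-> /negPf->].
rewrite mem_cat; case: ifP => [_ _|_ /= cP]; first by lra.
by rewrite cP; case/andP: (yc _ cP).
Qed.

Lemma class_massE (F P : seq nat) (y : R) c :
  {in P, forall c, (c < 10)%N} ->
  a c * class_weight F P y c =
  if c \in F then a c else if c \in P then y else 0.
Proof.
move=> P10; rewrite /class_weight; case: ifP => _; first by rewrite mulr1.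
case: ifP => [cP|_]; last by rewrite mulr0.
rewrite mulrC divfK // gt_eqF //.
have := size_near (P10 _ cP); rewrite ler_norml => /andP[+ _].
have : 0 < N by rewrite ltr0n.
by lra.
Qed.

(* [star 0] is 0, 2, 8, 9; the remaining six classes span the perfect matching
   1-6, 3-4, 5-7, which splits into the transversals [1; 3; 5] and [6; 4; 7]. *)
Lemma sparse_half_of_classes (beta eta : R) :
  0 <= beta -> 0 <= eta <= 1 / 20000 ->
  3 / 100 * N * beta <= \sum_u \sum_v (missing u v)%:R ->
  \sum_u \sum_v (extra u v)%:R <= 2 * eta * N * (beta + a 10%N) ->
  exists S : {set T}, #|S| = #|T|./2 /\
    #|spanned_edges e S|%:R <= N ^+ 2 / 50.
Proof.
move=> b0 /andP[eta0 eta1] hmiss hextra.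
have N0 : 0 < N by rewrite ltr0n.
have near i : (i < 10)%N -> a i - N / 10 <= N / 1000 /\ - (N / 1000) <= a i - N / 10.
  by move=> /size_near; rewrite ler_norml => /andP[? ?].
have [A0 A0'] := near 0%N isT; have [A1 A1'] := near 1%N isT.
have [A2 A2'] := near 2%N isT; have [A3 A3'] := near 3%N isT.
have [A4 A4'] := near 4%N isT; have [A5 A5'] := near 5%N isT.
have [A6 A6'] := near 6%N isT; have [A7 A7'] := near 7%N isT.
have [A8 A8'] := near 8%N isT; have [A9 A9'] := near 9%N isT.
have B1 := size_exc (isT : 10 <= 11 < 15)%N; have B2 := size_exc (isT : 10 <= 12 < 15)%N.
have B3 := size_exc (isT : 10 <= 13 < 15)%N; have B4 := size_exc (isT : 10 <= 14 < 15)%N.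
have B10 : 0 <= a 10%N by rewrite ler0n.
have B11 : 0 <= a 11%N by rewrite ler0n.
have B12 : 0 <= a 12%N by rewrite ler0n.
have B13 : 0 <= a 13%N by rewrite ler0n.
have B14 : 0 <= a 14%N by rewrite ler0n.
have asum := sum_class_size; rewrite (sum_ord15 a) in asum.
pose y := (N / 2 - (a 0%N + a 2%N + a 8%N + a 9%N)) / 3.
pose z1 := (N / 2 - (a 1%N + a 3%N + a 5%N) - a 10%N) / 3.
pose z2 := (N / 2 - (a 6%N + a 4%N + a 7%N) - a 10%N) / 3.
have b_le : a 10%N <= 1 / 100 * N.
  move: A0' A1' A2' A3' A4' A5' A6' A7' A8' A9' B11 B12 B13 B14 asum; clear.
  by move: (a) N => c M *; lra.
have [y_ge y_le] : 31 / 1000 * N <= y /\ y <= 7 / 100 * N.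
  rewrite /y; move: A0 A0' A2 A2' A8 A8' A9 A9'; clear.
  by move: (a 0%N) (a 2%N) (a 8%N) (a 9%N) N => *; split; lra.
have [z1_ge z1_le] : 31 / 1000 * N <= z1 /\ z1 <= 7 / 100 * N.
  rewrite /z1; move: A1 A1' A3 A3' A5 A5' B10 b_le; clear.
  by move: (a 1%N) (a 3%N) (a 5%N) (a 10%N) N => *; split; lra.
have [z2_ge z2_le] : 31 / 1000 * N <= z2 /\ z2 <= 7 / 100 * N.
  rewrite /z2; move: A4 A4' A6 A6' A7 A7' B10 b_le; clear.
  by move: (a 4%N) (a 6%N) (a 7%N) (a 10%N) N => *; split; lra.
pose I := [:: 0; 2; 8; 9]%N; pose J := [:: 1; 3; 5]%N; pose K := [:: 6; 4; 7]%N.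
pose X : R := \sum_u \sum_v (extra u v)%:R.
pose Ms (s : seq nat) : R := \sum_u \sum_v
   [&& (phi u : nat) \in s, (phi v : nat) \in s & missing u v]%:R.
have strategy (F P : seq nat) (x q : R) :
    {in P, forall c, (c < 10)%N} -> 31 / 1000 * N <= x -> x <= 7 / 100 * N ->
    {in F ++ P &, forall c d, compatible c d} ->
    \sum_(c < 15) (if (c : nat) \in F then a c else if (c : nat) \in P then x else 0) = N / 2 ->
    (\sum_(c < 15) \sum_(d < 15)
      (if (c : nat) \in F then a c else if (c : nat) \in P then x else 0) *
      (if (d : nat) \in F then a d else if (d : nat) \in P then x else 0) *
      (adj c d)%:R) = q ->
    q - 9 / 100 * Ms (F ++ P) + X <= N ^+ 2 / 25 ->
    exists S : {set T}, #|S| = #|T|./2 /\ #|spanned_edges e S|%:R <= N ^+ 2 / 50.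
  move=> P10 lx ux ok sumN qE le_q.
  have [w01 w0 ws] := class_weight_bounds F P10 lx ux.
  have [||S [cS leS]] := @sparse_half_of_weights R T e esimple
     (fun u => class_weight F P x (phi u)).
  - by move=> u; apply: w01.
  - by rewrite (sum_class (class_weight F P x)) -sumN; apply: eq_bigr => c _; rewrite class_massE.
  exists S; split=> //.
  have := edge_form_class w01 w0 ws ok.
  have -> : \sum_(c < 15) \sum_(d < 15) a c * class_weight F P x c *
     (a d * class_weight F P x d) * (adj c d)%:R = q.
    by rewrite -qE; apply: eq_bigr => c _; apply: eq_bigr => d _; rewrite !class_massE.
  rewrite -/X -/(Ms _) => le_w.
  move: (le_trans leS (le_trans le_w le_q)); clear.
  by move: (#|_|%:R) (N ^+ 2) => *; lra.
pose q1 := 2 * y * (a 0%N + a 2%N + a 2%N + a 8%N + a 0%N + a 8%N).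
pose q2 := 2 * y * (a 8%N + a 9%N + a 0%N + a 9%N + a 2%N + a 9%N).
pose q3 := 2 * z1 * (a 1%N + a 3%N + a 5%N).
pose q4 := 2 * z2 * (a 6%N + a 4%N + a 7%N).
(* [I] is independent, so every edge of the Petersen graph lies within I and J, I and K, or J and
   K. *)
have cover : \sum_u \sum_v (missing u v)%:R <=
    Ms (I ++ J) + Ms (I ++ K) + Ms ((10%N :: J) ++ K) + Ms ((10%N :: K) ++ J).
  rewrite /Ms -!big_split /=; apply: ler_sum => u _.
  rewrite -!big_split /=; apply: ler_sum => v _.
  rewrite /missing; case: (e u v); rewrite ?andbF ?andbT /= -?natrD ?ler0n //.
  rewrite ler_nat.
  pose both (s : seq nat) (c d : nat) := (c \in s) && (d \in s).
  pose P (c d : nat) := adj c d ==> [|| both (I ++ J) c d, both (I ++ K) c d,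
     both ((10%N :: J) ++ K) c d | both ((10%N :: K) ++ J) c d].
  have := @forall_ord_iota2 15 15 P isT (phi u) (phi v).
  rewrite /P /both; case: (adj _ _) => //=; rewrite ?andbT ?andbF //.
  by do 4!case: (_ && _).
have avg : 1 / 20 * (q1 + q2) + 9 / 20 * (q3 + q4) <= N ^+ 2 / 25 - N * a 10%N / 50.
  apply: le_trans (_ : 1 / 20 * (6 * y * (a 0%N + a 2%N + a 8%N + a 9%N)) +
     9 / 20 * (q3 + q4) <= _).
    rewrite le_eqVlt; apply/orP; left; apply/eqP; rewrite /q1 /q2.
    by move: (a 0%N) (a 2%N) (a 8%N) (a 9%N) (y) (q3 + q4) => *; ring.
  apply: (@average_bound _ N _ _ _ _ (a 11%N + a 12%N + a 13%N + a 14%N)) => //.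
  - rewrite -asum; clear; move: (a) => c; ring.
  - move: B1 B2 B3 B4; clear; move: (a 10%N) (a 11%N) (a 12%N) (a 13%N) (a 14%N).
    by move=> *; lra.
  - move: A1' A3' A5'; clear; move: (a 1%N) (a 3%N) (a 5%N) N => *; lra.
  - move: A4' A6' A7'; clear; move: (a 4%N) (a 6%N) (a 7%N) N => *; lra.
have Xle : X <= 2 * eta * N * (beta + a 10%N) by [].
have Ms0 (s : seq nat) : 0 <= Ms s by apply: sumr_ge0 => u _; apply: sumr_ge0 => v _; apply: ler0n.
(* Missing pairs save at least 1/20 * 9/100 * 3/100 = 0.000135 times [N * beta], more than the
   0.0001 charged for extra edges; the share of [a 10] is absorbed by the slack N * a 10 / 50. *)
have total : 1 / 20 * (q1 - 9 / 100 * Ms (I ++ J) + X)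
   + 1 / 20 * (q2 - 9 / 100 * Ms (I ++ K) + X)
   + 9 / 20 * (q3 - 9 / 100 * Ms ((10%N :: J) ++ K) + X)
   + 9 / 20 * (q4 - 9 / 100 * Ms ((10%N :: K) ++ J) + X) <= N ^+ 2 / 25.
  have := Ms0 ((10%N :: J) ++ K); have := Ms0 ((10%N :: K) ++ J).
  have Nb : 0 <= N * beta by rewrite mulr_ge0 // ltW.
  have Na : 0 <= N * a 10%N by rewrite mulr_ge0 // ltW.
  have : X <= 1 / 10000 * (N * beta + N * a 10%N).
    apply: le_trans Xle _.
    have : eta * (N * beta + N * a 10%N) <= 1 / 20000 * (N * beta + N * a 10%N).
      by apply: ler_wpM2r => //; apply: addr_ge0.
    by clear; move: (a 10%N) N => *; lra.
  have : 3 / 100 * (N * beta) <=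
      Ms (I ++ J) + Ms (I ++ K) + Ms ((10%N :: J) ++ K) + Ms ((10%N :: K) ++ J).
    by apply: le_trans cover; rewrite mulrA.
  move: avg Nb Na; clear.
  move: (Ms (I ++ J)) (Ms (I ++ K)) (Ms ((10%N :: J) ++ K)) (Ms ((10%N :: K) ++ J)).
  move: (q1) (q2) (q3) (q4) (X) (N * beta) (N * a 10%N) (N ^+ 2) => *; lra.
have lt10 (s : seq nat) : all (fun c => c < 10)%N s -> {in s, forall c, (c < 10)%N}.
  by move/allP.
have okP (s : seq nat) : all (fun c => all (compatible c) s) s ->
    {in s &, forall c d, compatible c d}.
  by move=> /allP h c d /h /allP hc /hc.
pose mass (F P : seq nat) (x : R) (c : nat) : R :=
  if c \in F then a c else if c \in P then x else 0.
(* Since the average is at most N^2/25, one of the four costs is, and [strategy] rounds that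
   weighting. *)
have [le1|gt1] := leP (q1 - 9 / 100 * Ms (I ++ J) + X) (N ^+ 2 / 25).
  apply: (strategy I J y q1 _ _ _ _ _ _ le1).
  - exact: lt10.
  - exact: y_ge.
  - exact: y_le.
  - exact: okP.
  - rewrite (sum_ord15 (mass I J y)) /mass /= /y.
    by move: (a) N => c M; field.
  rewrite (adj_form (mass I J y)) /mass /= /q1.
  by move: (a) => c; ring.
have [le2|gt2] := leP (q2 - 9 / 100 * Ms (I ++ K) + X) (N ^+ 2 / 25).
  apply: (strategy I K y q2 _ _ _ _ _ _ le2).
  - exact: lt10.
  - exact: y_ge.
  - exact: y_le.
  - exact: okP.
  - rewrite (sum_ord15 (mass I K y)) /mass /= /y.
    by move: (a) N => c M; field.
  rewrite (adj_form (mass I K y)) /mass /= /q2.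
  by move: (a) => c; ring.
have [le3|gt3] := leP (q3 - 9 / 100 * Ms ((10%N :: J) ++ K) + X) (N ^+ 2 / 25).
  apply: (strategy (10%N :: J) K z1 q3 _ _ _ _ _ _ le3).
  - exact: lt10.
  - exact: z1_ge.
  - exact: z1_le.
  - exact: okP.
  - rewrite (sum_ord15 (mass (10%N :: J) K z1)) /mass /= /z1.
    by move: (a) N => c M; field.
  rewrite (adj_form (mass (10%N :: J) K z1)) /mass /= /q3.
  by move: (a) => c; ring.
have [le4|gt4] := leP (q4 - 9 / 100 * Ms ((10%N :: K) ++ J) + X) (N ^+ 2 / 25).
  apply: (strategy (10%N :: K) J z2 q4 _ _ _ _ _ _ le4).
  - exact: lt10.
  - exact: z2_ge.
  - exact: z2_le.
  - exact: okP.
  - rewrite (sum_ord15 (mass (10%N :: K) J z2)) /mass /= /z2.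
    by move: (a) N => c M; field.
  rewrite (adj_form (mass (10%N :: K) J z2)) /mass /= /q4.
  by move: (a) => c; ring.
exfalso; move: total gt1 gt2 gt3 gt4; clear.
move: (_ + X) (_ + X) (_ + X) (_ + X) (N ^+ 2) => *; lra.
Qed.
End ClassWeights.

(** * Classifying the vertices *)

Section Classification.
Variables (R : realFieldType) (T : finType) (e : rel T) (p : T -> 'I_10).
Variables (delta eta : R).
Hypothesis esimple : simple_graph e.
Hypothesis etf : triangle_free e.
Hypothesis T0 : (0 < #|T|)%N.
Local Notation N := (#|T|%:R : R).
Hypothesis eta0 : 0 < eta.
Hypothesis delta_eta : 2 * delta <= eta ^+ 2.
Hypothesis part_size : forall i : nat, (i < 10)%N ->
  `|#|[set u | p u == i :> nat]|%:R - N / 10| <= delta * N.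
Hypothesis few_diff :
  #|[set q : T * T | e q.1 q.2 != adj (p q.1) (p q.2)]|%:R <= 2 * delta * N ^+ 2.

Definition deg_in (v : T) (k : nat) : R := #|[set u | e v u && (p u == k :> nat)]|%:R.

Definition rich (v : T) (k : nat) : bool := eta * N < deg_in v k.

(** By triangle-freeness the neighbours of [v] in the two parts span no edge. Were the parts
    adjacent, these more than eta^2 N^2 pairs would all differ from the blow-up. *)
Lemma rich_independent v i j : rich v i -> rich v j -> ~~ adj i j.
Proof.
rewrite /rich => ri rj; apply/negP=> aij; have [esym _] := esimple.
have N0 : 0 < N by rewrite ltr0n.
have : deg_in v i * deg_in v j <= 2 * delta * N ^+ 2.
  apply: le_trans few_diff; rewrite -natrM -cardsX ler_nat subset_leq_card //.
  apply/subsetP=> -[x y]; rewrite !inE /= => /andP[/andP[vx /eqP->] /andP[vy /eqP->]].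
  rewrite aij; apply: contraNneq (etf v x y) => exy.
  by rewrite vx exy vy.
apply/negP; rewrite -ltNge.
apply: le_lt_trans (_ : (eta * N) * (eta * N) < _).
  by rewrite -expr2 exprMn; apply: ler_wpM2r => //; apply: sqr_ge0.
have h0 : 0 <= eta * N by rewrite mulr_ge0 // ltW.
exact: ltr_pM.
Qed.

Definition well_placed (v : T) : bool :=
  all (fun k => rich v k ==> adj (p v) k) (iota 0 10).

(** The last clause keeps a vertex in its own part whenever possible, so that few vertices change
    label. *)
Lemma class_exists v : exists c : 'I_15,
  [/\ (c < 10)%N -> forall k, (k < 10)%N -> rich v k -> adj c k,
      (10 <= c)%N -> forall k, (k < 10)%N -> rich v k -> k \in star (c - 10) &
      well_placed v -> c = p v :> nat].
Proof.
have [wp|nwp] := boolP (well_placed v).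
  have p15 : (p v < 15)%N by rewrite (leq_trans (ltn_ord _)).
  exists (Ordinal p15); split=> //=; last by rewrite leqNgt ltn_ord.
  move=> _ k k10 rk; move/allP: wp => /(_ k); rewrite mem_iota /= add0n k10 rk.
  exact.
have [|[i i10 h]|[x x5 h]] := @independent_cases (rich v).
- by move=> i j _ _; apply: rich_independent.
- have i15 : (i < 15)%N by rewrite (leq_trans i10).
  by exists (Ordinal i15); split=> //=; rewrite leqNgt i10.
- have x15 : (10 + x < 15)%N by rewrite ltn_add2l.
  exists (Ordinal x15); split; [by move=> /= ?; exfalso; lia| |].
    by move=> _ k k10 rk; rewrite /= (_ : _ - 10 = x)%N; [apply: h|lia].
  by [].
Qed.

Variable phi : T -> 'I_15.
Hypothesis phi_core : forall v, (phi v < 10)%N ->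
  forall k, (k < 10)%N -> rich v k -> adj (phi v) k.
Hypothesis phi_star : forall v, (10 <= phi v)%N ->
  forall k, (k < 10)%N -> rich v k -> k \in star (phi v - 10).
Hypothesis phi_placed : forall v, well_placed v -> phi v = p v :> nat.

Definition moved (v : T) : bool := phi v != p v :> nat.

(** A moved vertex has more than [eta * N] neighbours in some part not adjacent to its own, and each
    such pair differs from the blow-up. *)
Lemma card_moved : eta * #|[set v | moved v]|%:R <= 2 * delta * N.
Proof.
have N0 : 0 < N by rewrite ltr0n.
rewrite -(ler_pM2r N0) -[leRHS]mulrA -expr2; apply: le_trans few_diff.
rewrite -(sum2_bool R (fun u v => e u v != adj (p u) (p v))).
rewrite mulrAC mulrC -sumr_bool mulr_suml.
apply: ler_sum => v _; rewrite sumr_bool.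
have [mv|] := boolP (moved v); last by rewrite mul0r ler0n.
rewrite mul1r.
have : ~~ well_placed v by apply: contra mv => /phi_placed->.
case/allPn=> k; rewrite mem_iota /= add0n => k10.
rewrite negb_imply => /andP[/ltW rk nadj]; apply: le_trans rk _.
apply: card_set_ler => u /andP[-> /eqP->]; by rewrite (negPf nadj).
Qed.

Lemma class_size_near (mu : R) i : (i < 10)%N -> #|[set v | moved v]|%:R <= mu * N ->
  `|#|[set u | phi u == i :> nat]|%:R - N / 10| <= (delta + mu) * N.
Proof.
move=> i10 hm; have := part_size i10; rewrite !ler_norml => /andP[h1 h2].
have := @card_set_ler2 R T (fun u => p u == i :> nat) (fun u => phi u == i :> nat) moved.
have := @card_set_ler2 R T (fun u => phi u == i :> nat) (fun u => p u == i :> nat) moved.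
have H (u : T) : (phi u == i :> nat) -> (p u == i :> nat) || moved u.
  by rewrite /moved => /eqP->; case: eqP => //= /eqP; rewrite eq_sym.
have H' (u : T) : (p u == i :> nat) -> (phi u == i :> nat) || moved u.
  by rewrite /moved => /eqP->; case: eqP.
move=> /(_ H) h3 /(_ H') h4; move: h1 h2 h3 h4 hm; clear.
move: #|_|%:R #|[set u | phi u == i :> nat]|%:R #|[set v | moved v]|%:R N.
by move=> A B C M *; apply/andP; split; lra.
Qed.

Lemma few_outside v (B : pred nat) :
  (forall k, (k < 10)%N -> rich v k -> B k) ->
  #|[set u | e v u && ~~ B (p u)]|%:R <= 10 * eta * N.
Proof.
move=> hB; have N0 : 0 < N by rewrite ltr0n.
rewrite -sumr_bool (partition_big p predT) //=.
apply: le_trans (_ : \sum_(k < 10) eta * N <= _); last first.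
  by rewrite sumr_const card_ord -(mulr_natl (eta * N)) mulrA.
apply: ler_sum => k _.
have [Bk|nBk] := boolP (B k).
  rewrite big1 ?mulr_ge0 ?ltW // => u /eqP->; by rewrite Bk andbF.
have : ~~ rich v k by apply: contra nBk => /hB; apply; apply: ltn_ord.
rewrite /rich -leNgt; apply: le_trans; rewrite /deg_in -sumr_bool big_mkcond /=.
apply: ler_sum => u _; rewrite -val_eqE /=.
by case: eqP => //= ->; rewrite ?nBk ?andbT ?andbF ?ler0n.
Qed.

(** The threshold 3/50 is half of 1/10 + 1/50: two vertices above it in one part of size below 6N/50
    share a neighbour there. *)
Definition poor (v : T) : bool :=
  (phi v < 10)%N && has (fun k => adj (phi v) k && (deg_in v k <= 3 / 50 * N)) (iota 0 10).

(** Class [k] has nearly N/10 vertices, of which at most 3N/50 are neighbours lying in part [k]. One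
    [mu] pays for the class size, the other for moved vertices. *)
Lemma poor_missing (mu : R) v : poor v -> #|[set v | moved v]|%:R <= mu * N ->
  delta + 2 * mu <= 1 / 100 ->
  3 / 100 * N <= #|[set u | adj (phi v) (phi u) && ~~ e v u]|%:R.
Proof.
case/andP=> v10 /hasP[k]; rewrite mem_iota /= add0n => k10 /andP[avk dk] hm hmu.
have := class_size_near k10 hm; rewrite ler_norml => /andP[h1 _].
have H (u : T) : (phi u == k :> nat) ->
   (adj (phi v) (phi u) && ~~ e v u) || ((e v u && (p u == k :> nat)) || moved u).
  move=> /eqP uk; rewrite /moved uk avk /=; case: (e v u) => //=.
  by rewrite eq_sym; case: eqP.
have h2 := card_set_ler2 R H.
have h3 := @card_set_ler2 R T (fun u => (e v u && (p u == k :> nat)) || moved u)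
   (fun u => e v u && (p u == k :> nat)) moved (fun u h => h).
have hN : (delta + 2 * mu) * N <= 1 / 100 * N by apply: ler_wpM2r.
move: h1 h2 h3 dk hm hN; rewrite -/(deg_in v k); clear.
move: (deg_in v k) #|[set u | phi u == k :> nat]|%:R #|[set v | moved v]|%:R.
by move: #|_|%:R #|_|%:R N => *; lra.
Qed.

Lemma few_extra_core (mu : R) v : (phi v < 10)%N -> #|[set v | moved v]|%:R <= mu * N ->
  #|[set u | e v u && ~~ adj (phi v) (phi u)]|%:R <= (10 * eta + mu) * N.
Proof.
move=> v10 hm; rewrite mulrDl.
apply: le_trans (lerD (few_outside (phi_core v10)) hm).
apply: card_set_ler2 => u /andP[-> nadj] /=; rewrite /moved.
by case: eqP => [<-|_]; rewrite ?nadj ?orbT.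
Qed.

Lemma few_extra_star (mu : R) v : (10 <= phi v)%N -> #|[set v | moved v]|%:R <= mu * N ->
  #|[set u | e v u && ((phi u : nat) \notin star (phi v - 10)) ]|%:R <= (10 * eta + mu) * N.
Proof.
move=> v10 hm; rewrite mulrDl.
apply: le_trans (lerD (@few_outside v (mem (star (phi v - 10))) (phi_star v10)) hm).
apply: card_set_ler2 => u /andP[-> nadj] /=; rewrite /moved.
by case: eqP => [<-|_]; rewrite ?nadj ?orbT.
Qed.

(* The endpoints of an edge have no common neighbour, so they cannot both see
   most of the part of a common Petersen neighbour of their classes. *)
Lemma extra_edge_poor u v : delta < 1 / 50 ->
  (phi u < 10)%N -> (phi v < 10)%N -> e u v -> ~~ adj (phi u) (phi v) ->
  poor u || poor v.
Proof.
move=> d50 u10 v10 euv nadj; have [esym _] := esimple.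
have N0 : 0 < N by rewrite ltr0n.
have [k uk vk] := @common_neighbour (Ordinal u10) (Ordinal v10) nadj.
have : deg_in u k + deg_in v k <= #|[set w | p w == k :> nat]|%:R.
  rewrite /deg_in -!sumr_bool -big_split; apply: ler_sum => w _ /=.
  have := etf u v w; rewrite euv /=.
  by case: eqP; case: (e u w); case: (e v w) => //= *; rewrite ?addr0 ?add0r.
have := part_size (ltn_ord k); rewrite ler_norml => /andP[_ h1] h2.
have dN : delta * N < 1 / 50 * N by rewrite ltr_pM2r.
have : (deg_in u k <= 3 / 50 * N) || (deg_in v k <= 3 / 50 * N).
  rewrite -[_ || _]negbK negb_or -!ltNge; apply/negP=> /andP[].
  move: h1 h2 dN; clear; move: (deg_in u k) (deg_in v k) #|_|%:R N => *; lra.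
have k_iota : (k : nat) \in iota 0 10 by rewrite mem_iota /= add0n ltn_ord.
case/orP=> dk; apply/orP; [left|right]; rewrite /poor ?u10 ?v10 andTb.
  by apply/hasP; exists (k : nat); rewrite // uk.
by apply/hasP; exists (k : nat); rewrite // vk.
Qed.
End Classification.

(** * Graphs close to the Petersen graph *)

Lemma compatible_sym : symmetric compatible.
Proof.
move=> c d; rewrite /compatible [X in X || _]andbC; congr (_ || _).
by case: (c <= 10)%N; case: (d <= 10)%N; rewrite //= andbC.
Qed.

(** Each pair is charged to the row or the column of an end in [Z], hence the factor 2. *)
Lemma sum_le_rows (R : realFieldType) (T : finType) (r : rel T) (Z : pred T)
    (M : R) :
  symmetric r -> (forall u v, r u v -> Z u || Z v) ->
  (forall u, Z u -> #|[set v | r u v]|%:R <= M) ->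
  \sum_u \sum_v (r u v)%:R <= 2 * M * #|[set u | Z u]|%:R.
Proof.
move=> rsym rZ rM; pose h u v : R := (Z u && r u v)%:R.
apply: le_trans (_ : \sum_u \sum_v (h u v + h v u) <= _).
  apply: ler_sum => u _; apply: ler_sum => v _; rewrite /h (rsym v u) -natrD ler_nat.
  by have := rZ u v; case: (r u v) => // /(_ isT); case: (Z u); case: (Z v).
have row u : \sum_v h u v <= M * (Z u)%:R.
  have [Zu|nZu] := boolP (Z u); last by rewrite big1 ?mulr0 // => v _; rewrite /h (negPf nZu).
  rewrite mulr1; apply: le_trans (rM u Zu); rewrite -sumr_bool.
  by apply: ler_sum => v _; rewrite /h Zu.
have half : \sum_u \sum_v h u v <= M * #|[set u | Z u]|%:R.
  by rewrite -sumr_bool mulr_sumr; apply: ler_sum => u _.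
under eq_bigr do rewrite big_split /=.
rewrite big_split /= [X in _ + X]exchange_big /= -mulrA mulrDl mul1r.
exact: lerD.
Qed.

Section NearPetersen.
Variables (R : realFieldType) (T : finType) (e : rel T) (p : T -> 'I_10).
Variables (delta eta : R).
Hypothesis esimple : simple_graph e.
Hypothesis etf : triangle_free e.
Hypothesis T0 : (0 < #|T|)%N.
Local Notation N := (#|T|%:R : R).
Hypothesis eta0 : 0 < eta.
Hypothesis eta_small : 204 * (1000 * eta) <= 1.
Hypothesis deltaE : delta = eta ^+ 2 / 10.
Hypothesis part_size : forall i : nat, (i < 10)%N ->
  `|#|[set u | p u == i :> nat]|%:R - N / 10| <= delta * N.
Hypothesis few_diff :
  #|[set q : T * T | e q.1 q.2 != adj (p q.1) (p q.2)]|%:R <= 2 * delta * N ^+ 2.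

Lemma sparse_half_near_petersen : exists S : {set T},
  #|S| = #|T|./2 /\ #|spanned_edges e S|%:R <= N ^+ 2 / 50.
Proof.
have N0 : 0 < N by rewrite ltr0n.
have [eta_gt0 eta_le] := (eta0, eta_small).
have [esym eirr] := esimple.
(* The bound of [card_moved]: [2 * delta / eta] equals [eta / 5]. *)
pose mu := eta / 5.
have /andP[eta2_ge0 eta2_le] : 0 <= eta ^+ 2 <= eta.
  rewrite sqr_ge0 /=; rewrite expr2 -[leRHS]mulr1 ler_pM2l //.
  by lra.
have delta_eta : 2 * delta <= eta ^+ 2 by rewrite deltaE; lra.
have d_mu : delta + 2 * mu <= 1 / 1000.
  by rewrite deltaE /mu; lra.
have d50 : delta < 1 / 50 by rewrite deltaE; lra.
have le100 : delta + 2 * mu <= 1 / 100 by lra.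
have le1000 : delta + mu <= 1 / 1000.
  by apply: le_trans d_mu; rewrite /mu; lra.
have [phi /all_and3[phi_core phi_star phi_placed]] :=
  fin_all_exists (class_exists esimple etf T0 eta0 delta_eta few_diff).
have hm : #|[set v | moved p phi v]|%:R <= mu * N.
  have := card_moved T0 few_diff phi_placed.
  have -> : 2 * delta * N = eta * (mu * N) by rewrite deltaE /mu; field.
  by rewrite ler_pM2l.
pose Bn (x : 'I_5) := #|[set u | phi u == (10 + x)%N :> nat]|.
have [x xmax] : exists x, forall y, (Bn y <= Bn x)%N.
  have [x _ xmax] := @arg_maxnP 'I_5 ord0 predT Bn isT.
  by exists x => y; apply: xmax.
have rotF c d := @rot_class_facts x c d (ltn_ord x).
(* Relabelling by the rotation gives the largest exceptional class the label 10. *)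
pose psi u : 'I_15 := inord (rot_class x (phi u)).
have psiE u : psi u = rot_class x (phi u) :> nat.
  by rewrite inordK //; case: (rotF (phi u) 0%N (ltn_ord _) isT).
have adj_psi u v : adj (psi u) (psi v) = adj (phi u) (phi v).
  by rewrite !psiE; case: (rotF (phi u) (phi v) (ltn_ord _) (ltn_ord _)).
have psi_lt u : (psi u < 10)%N = (phi u < 10)%N.
  by rewrite !psiE; case: (rotF (phi u) 0%N (ltn_ord _) isT).
have psi_eq d u : (d < 15)%N -> (psi u == d :> nat) = (phi u == unrot_class x d :> nat).
  by move=> d15; rewrite psiE; case: (rotF (phi u) d (ltn_ord _) d15).
have sizeE d : (d < 15)%N ->
    class_size R psi d = #|[set u | phi u == unrot_class x d :> nat]|%:R.
  by move=> d15; congr _%:R; apply: eq_card => u; rewrite !inE psi_eq.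
have unrot10 (y : 'I_5) : unrot_class y 10 = (10 + y)%N.
  by apply/eqP; apply: (@forall_ord_iota 5 (fun y => unrot_class y 10 == 10 + y)%N isT y).
pose poorv := @poor R T e p phi.
have extra_sym : symmetric (extra e psi).
  by move=> u v; rewrite /extra esym adj_sym compatible_sym.
(* Here [10 * eta + mu] is 10.2 eta, and 10.2 * 20000 = 204 * 1000 accounts for [eta_small]. *)
have half_eta : (10 * eta + mu) * N <= 1 / 20000 * N.
  by apply: ler_wpM2r => //; rewrite /mu; lra.
have row_extra u : poorv u || (psi u == 10 :> nat) ->
    #|[set v | extra e psi u v]|%:R <= 1 / 20000 * N.
  move=> Zu; apply: le_trans half_eta.
  have [u10|u10] := ltnP (phi u) 10.
    apply: le_trans (few_extra_core T0 eta0 phi_core u10 hm).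
    by apply: card_set_ler => v /and3P[-> nadj _]; rewrite -adj_psi.
  apply: le_trans (few_extra_star T0 eta0 phi_star u10 hm).
  have psi10 : psi u = 10 :> nat.
    by case/orP: Zu => [/andP[]|/eqP //]; rewrite ltnNge u10.
  have phi10 : phi u = (10 + x)%N :> nat.
    by apply/eqP; rewrite -unrot10 -psi_eq // psi10.
  (* A class compatible with 10 avoids [star 0], so before rotation the other end is outside I_x,
     where vertices of B_x have few neighbours. *)
  apply: card_set_ler => v /and3P[-> _]; rewrite /compatible psi10.
  case/orP=> [/andP[]//|/and4P[_ _ _ vs]].
  rewrite phi10 addKn; have [lt_v|ge_v] := ltnP (phi v) 10.
    by rewrite -rot_class_star // -psiE.
  apply: contraL ge_v => vstar; rewrite -ltnNge.
  have := @forall_ord_iota 5 (fun y => all (fun c => c < 10)%N (star y)) isT x.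
  by move=> /allP/(_ _ vstar).
(* Between ordinary classes the edge has a poor end; otherwise compatibility forces an end into
   class 10. *)
have extra_end u v : extra e psi u v ->
    (poorv u || (psi u == 10 :> nat)) || (poorv v || (psi v == 10 :> nat)).
  case/and3P=> euv nadj cmp.
  have [u10|u10] := boolP (psi u < 10)%N; last first.
    case/orP: cmp => [/andP[]|/and4P[u10' _ _ _]]; first by rewrite (negPf u10).
    have -> : psi u = 10 :> nat.
      by apply/eqP; rewrite eqn_leq u10' leqNgt u10.
    by rewrite eqxx orbT.
  have [v10|v10] := boolP (psi v < 10)%N; last first.
    case/orP: cmp => [/andP[_]|/and4P[_ v10' _ _]]; first by rewrite (negPf v10).
    have -> : psi v = 10 :> nat.
      by apply/eqP; rewrite eqn_leq v10' leqNgt v10.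
    by rewrite eqxx !orbT.
  rewrite !psi_lt in u10 v10; rewrite adj_psi in nadj.
  have := extra_edge_poor esimple etf T0 part_size d50 u10 v10 euv nadj.
  by rewrite -/poorv => /orP[]->; rewrite ?orbT.
(* [beta] counts the poor vertices: each gives 3N/100 missing pairs, and extra edges lie in the rows
   and columns of poor vertices and of B_0. *)
apply: (@sparse_half_of_classes R T e psi esimple T0 _ _
   #|[set u | poorv u]|%:R (1 / 20000)) => //.
- move=> i i10; have i15 : (i < 15)%N by rewrite (leq_trans i10).
  rewrite sizeE //.
  have [_ _ _ _ [_ ui]] := rotF 0%N i isT i15; rewrite i10 in ui.
  apply: le_trans (class_size_near part_size (Logic.eq_sym ui) hm) _.
  rewrite [leRHS]mulrC -[X in _ <= X * _]mul1r; exact: ler_wpM2r.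
- move=> c /andP[c10 c15]; rewrite !sizeE // unrot10 ler_nat.
  have [_ _ _ _ [u15 uc]] := rotF 0%N c isT c15.
  have u10 : (10 <= unrot_class x c)%N by rewrite leqNgt -uc -leqNgt.
  have y5 : (unrot_class x c - 10 < 5)%N by rewrite -(ltn_add2l 10) subnKC.
  by have := xmax (Ordinal y5); rewrite /Bn /= subnKC.
- by rewrite lexx divr_ge0.
- rewrite -sumr_bool mulr_sumr; apply: ler_sum => u _; rewrite sumr_bool.
  have [pu|_] := boolP (poorv u); last by rewrite mulr0 ler0n.
  rewrite mulr1.
  apply: le_trans (poor_missing part_size pu hm le100) _.
  by apply: card_set_ler => v; rewrite /missing adj_psi.
apply: le_trans (sum_le_rows extra_sym extra_end row_extra) _.
rewrite -[2 * _ * N]mulrA; apply: ler_wpM2l; first by rewrite !mulr_ge0 ?invr_ge0.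
exact: card_set_ler2.
Qed.
End NearPetersen.

Theorem theorem6p3 (R : realType) :
  exists delta : R, 0 < delta /\
    forall (n : nat) (T : finType) (e : rel T),
      #|T| = n -> simple_graph e -> triangle_free e ->
      petersen_approximable delta e ->
      exists S : {set T},
        #|S| = n./2 /\ #|spanned_edges e S|%:R <= n%:R ^+ 2 / 50 :> R.
Proof.
(* Any positive value up to 1/204000 satisfies [eta_small]. *)
pose eta : R := 1 / 1000 * (1 / 1000).
have eta0 : 0 < eta by rewrite /eta; lra.
exists (eta ^+ 2 / 10); split; first by rewrite divr_gt0 // exprn_gt0.
move=> n T e <- esimple etf [V [[Vcover Vdisj] Vsize Vdiff]].
have [T0|T0] := posnP #|T|.
  have [||S [cS leS]] := @sparse_half_of_weights R T e esimple (fun=> 0).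
  - by move=> u; rewrite lexx ler01.
  - by rewrite big1 // T0 mul0r.
  exists S; split=> //; move: leS; rewrite T0 expr0n /= mul0r.
  rewrite /edge_form big1 => [|u _]; first by rewrite pmulr_rle0.
  by rewrite big1 // => v _; rewrite !mul0r.
have /fin_all_exists[p pV] : forall u, exists i, u \in V i.
  move=> u; have : u \in \bigcup_i V i by rewrite Vcover inE.
  by case/bigcupP=> i _ ui; exists i.
have VE i u : (u \in V i) = (p u == i).
  apply/idP/eqP => [ui|<-//]; apply/eqP/negPn/negP => /Vdisj/disjointFr/(_ (pV u)).
  by rewrite ui.
have blowupE u v : blowup petersen V u v = adj (p u) (p v).
  rewrite -petersenE; apply/existsP/idP => [[i /existsP[j]]|puv].
    by rewrite !VE => /and3P[pij /eqP-> /eqP->].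
  by exists (p u); apply/existsP; exists (p v); rewrite puv !pV.
have [esym eirr] := esimple.
have [bsym birr] : simple_graph (blowup petersen V).
  by apply: blowup_simple_graph petersen_simple_graph _; split.
apply: (@sparse_half_near_petersen R T e p (eta ^+ 2 / 10) eta) => //.
- by rewrite /eta; lra.
- move=> i i10; have := Vsize (Ordinal i10).
  by congr (`|_%:R - _| <= _); apply: eq_card => u; rewrite VE inE.
move: Vdiff; rewrite symdiff_edges // => Vdiff.
(* Ordered pairs count each differing edge twice, whence [2 * delta] in [few_diff]. *)
have -> : #|[set q : T * T | e q.1 q.2 != adj (p q.1) (p q.2)]|
    = (#|edges [rel x y | e x y != blowup petersen V x y]| * 2)%N.
  rewrite card_edges; first by apply: eq_card => q; rewrite !inE /= blowupE.
  by split=> [u v|u] /=; rewrite ?eirr ?birr // esym bsym.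
by rewrite natrM mulrC -mulrA ler_pM2l.
Qed.
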